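(* Let $\mu\in[1/3,1/2]$ and put $$q_0^{\mu}=\frac{1-\mu}{2},\qquad q_{\pm}^{\mu}=\frac14\Big[(1+\mu)\pm\sqrt{(1+\mu)^2-4(1-\mu)^2}\Big],\qquad \theta^{\mu}=\cos^{-1}\Big[\frac{-\mu}{1-\mu}\Big].$$ Let $(q_0,q_1,q_2)$ be any permutation of $(q_+^{\mu},q_0^{\mu},q_-^{\mu})$, and let $\mathcal{U}$ be the associated unitary matrix $$\mathcal{U}=\begin{pmatrix}\sqrt{q_0}&\sqrt{q_1}&\sqrt{q_2}\\ \sqrt{q_1}&\sqrt{q_2}\,e^{i\xi_0}&\sqrt{q_0}\,e^{i\xi_1}\\ \sqrt{q_2}&\sqrt{q_0}\,e^{i\eta_1}&\sqrt{q_1}\,e^{i\eta_0}\end{pmatrix},$$ with real phases $\xi_0,\xi_1,\eta_0,\eta_1$ determined by unitarity. Let $(\alpha_1,\alpha_2)$ and $(\beta_1,\beta_2)$ be distinct pairs taking their values from the set $$(0,\theta^{\mu}),\qquad(\theta^{\mu},0),\qquad(\theta^{\mu},\theta^{\mu}),$$ and define $\mathcal{V}=\mathcal{D}_\alpha\,\mathcal{U}$ and $\mathcal{W}=\mathcal{D}_\beta\,\mathcal{U}$, where $\mathcal{D}_\alpha=\mathrm{diag}\{1,e^{i\alpha_1},e^{i\alpha_2}\}$ and $\mathcal{D}_\beta=\mathrm{diag}\{1,e^{i\beta_1},e^{i\beta_2}\}$. Then, starting from the standard basis $\{|e_k^{(1)}\rangle\}_{k=0}^{2}$ of $\mathbb{C}^3$,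 the four bases $$\{|e_k^{(1)}\rangle\},\quad\{\mathcal{U}|e_k^{(1)}\rangle\},\quad\{\mathcal{V}|e_k^{(1)}\rangle\},\quad\{\mathcal{W}|e_k^{(1)}\rangle\}\qquad(k=0,1,2)$$ form a set of four mutually equibiased bases (MEBs) associated with $q=(q_0,q_1,q_2)$; as $\mu$ ranges over $[1/3,1/2]$ this gives a one-parameter class of sets of four MEBs.
   Context: Mutually equibiased bases: let $\mathcal{H}$ be a $d$-dimensional complex Hilbert space and $q=(q_0,\ldots,q_{d-1})$ a probability distribution. A set of $L$ orthonormal bases $\mathcal{B}^{(\alpha)}=\{|e_k^{(\alpha)}\rangle\}_{k=0}^{d-1}$, $\alpha=1,\ldots,L$, of $\mathcal{H}$ is called a set of mutually equibiased bases (MEBs) associated with $q$ if for every pair $\alpha\neq\beta$ there is a permutation $\sigma$ of $\{0,1,\ldots,d-1\}$ (which may depend on the pair $(\alpha,\beta)$) such that $$\mathrm{Tr}\big[P_k^{(\alpha)}P_l^{(\beta)}\big]=q_{\sigma(k)\oplus\sigma(l)}\qquad\text{for all }k,l\in\{0,\ldots,d-1\},$$ where $P_k^{(\alpha)}=|e_k^{(\alpha)}\rangle\langle e_k^{(\alpha)}|$ and $\oplus$ denotes addition modulo $d$. By convention $\mathcal{B}^{(1)}$ is the standard (computational) basis, and $\sigma$ is taken to be the identity when one of the two bases is the standard basis. Here $d=3$. The parameter $\mu$ is the index of coincidence $\mu=q_0^2+q_1^2+q_2^2$. Phases of $\mathcal{U}$: with $L_0=\sqrt{q_1q_2}$, $L_1=\sqrt{q_2q_0}$,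 $L_2=\sqrt{q_0q_1}$, unitarity of $\mathcal{U}$ amounts to $$L_2+L_0e^{i\xi_0}+L_1e^{i\xi_1}=0,\quad L_1+L_2e^{i\eta_1}+L_0e^{i\eta_0}=0,\quad L_0+L_1e^{i(\xi_0-\eta_1)}+L_2e^{i(\xi_1-\eta_0)}=0,$$ which is solvable when $L_0,L_1,L_2$ satisfy the triangle inequalities, and then $$\cos\xi_0=\cos(\eta_0-\eta_1)=\tfrac{L_1^2-L_0^2-L_2^2}{2L_0L_2},\quad\cos\xi_1=\cos\eta_1=\tfrac{L_0^2-L_1^2-L_2^2}{2L_1L_2},\quad\cos(\xi_0-\xi_1)=\cos\eta_0=\tfrac{L_2^2-L_0^2-L_1^2}{2L_0L_1}.$$
   Formalization: The choice of the two pairs (0,θ) and (θ,0) is allowed only at μ=1/2; for μ<1/2 one of the two pairs must be (θ,θ), since otherwise V and W are not equibiased (e.g. at μ=1/3 they give the same basis up to order and phases). *)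

(* Defs.v *)
From HB Require Import structures.
From mathcomp Require Import all_boot all_order all_fingroup all_algebra.
From mathcomp Require Import spectral.
From mathcomp Require Import complex.
From mathcomp Require Import reals trigo.

Set Implicit Arguments.
Unset Strict Implicit.
Unset Printing Implicit Defensive.

Import Order.TTheory GRing.Theory Num.Theory.

Local Open Scope ring_scope.
Local Open Scope sesquilinear_scope.
Local Open Scope complex_scope.

(* A family of d vectors of C^d; its members are column vectors, |e_k>. *)
Definition frame (R : realType) (d : nat) : Type := 'I_d -> 'cV[R[i]]_d.

(* [<e_k|e_l>] is the single entry of the 1 x 1 matrix e_k^* e_l.  Being d
   orthonormal vectors of C^d, such a family is automatically a basis. *)
Definition orthonormal_basis (R : realType) (d : nat) (e : frame R d) : Prop :=
  forall k l, ((e k)^t* *m e l) 0 0 = (k == l)%:R.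

Definition projector (R : realType) (d : nat) (v : 'cV[R[i]]_d) :
  'M[R[i]]_d := v *m v^t*.

Definition std_basis {R : realType} {d : nat} : frame R d :=
  fun k => delta_mx k 0.

Definition transport (R : realType) (d : nat) (M : 'M[R[i]]_d)
  (e : frame R d) : frame R d := fun k => M *m e k.

Definition prob_distribution (R : realType) (d : nat) (q : 'I_d -> R) : Prop :=
  (forall k, 0 <= q k) /\ \sum_k q k = 1.

(* The dimension is d.+1, so that [+] on 'I_d.+1 is addition modulo d.+1. The
   permutation depends on the pair (a, b), and is the identity as soon as one
   of the two bases is the standard one. *)
Definition mutually_equibiased (R : realType) (d L : nat) (q : 'I_d.+1 -> R)
  (B : 'I_L -> frame R d.+1) : Prop :=
  [/\ prob_distribution q,
      forall a, orthonormal_basis (B a)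
    & forall a b, a != b ->
        exists s : {perm 'I_d.+1},
          (B a =1 std_basis \/ B b =1 std_basis -> s = 1%g) /\
          forall k l,
            \tr (projector (B a k) *m projector (B b l)) =
            (q (s k + s l))%:C].

Definition qzero (R : realType) (mu : R) : R := (1 - mu) / 2%:R.

Definition qplus (R : realType) (mu : R) : R :=
  ((1 + mu) + Num.sqrt ((1 + mu) ^+ 2 - 4%:R * (1 - mu) ^+ 2)) / 4%:R.

Definition qminus (R : realType) (mu : R) : R :=
  ((1 + mu) - Num.sqrt ((1 + mu) ^+ 2 - 4%:R * (1 - mu) ^+ 2)) / 4%:R.

Definition theta (R : realType) (mu : R) : R := acos (- mu / (1 - mu)).

Definition expi (R : realType) (x : R) : R[i] := cos x +i* sin x.

Definition matrix3 (R : realType) (rows : seq (seq R[i])) : 'M[R[i]]_3 :=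
  \matrix_(i < 3, j < 3) (nth [::] rows i)`_j.

Definition Umx (R : realType) (q : 'I_3 -> R) (xi0 xi1 eta0 eta1 : R) :
  'M[R[i]]_3 :=
  let r k := (Num.sqrt (q k))%:C in
  matrix3
    [:: [:: r 0;    r 1;                r 2%:R];
        [:: r 1;    r 2%:R * expi xi0;  r 0 * expi xi1];
        [:: r 2%:R; r 0 * expi eta1;    r 1 * expi eta0]].

Definition phase_mx (R : realType) (a : R * R) : 'M[R[i]]_3 :=
  matrix3
    [:: [:: 1; 0;         0];
        [:: 0; expi a.1;  0];
        [:: 0; 0;         expi a.2]].

(* Two distinct pairs a, b of this list do not always yield equibiased bases
   D_a U and D_b U: with c = cos (theta mu) = - mu / (1 - mu), the choice
   {(0, theta), (theta, 0)} gives
     sum_k Tr[P_k^(a) P_k^(b)] = 3 mu + (1 - mu) (2 c + 2 c^2 - 1),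
   whereas equibiasedness makes this sum equal to q_0 + q_1 + q_2 = 1, which
   forces mu = 1/2.  That choice is thus admissible only at mu = 1/2. *)
Definition phase_pairs (R : realType) (mu : R) : seq (R * R) :=
  [:: (0, theta mu); (theta mu, 0); (theta mu, theta mu)].

Definition four_bases (R : realType) (U V W : 'M[R[i]]_3) :
  'I_4 -> frame R 3 :=
  let e : frame R 3 := std_basis in
  tnth [tuple e; transport U e; transport V e; transport W e].

(* Main.v *)
Require Import Defs.
From mathcomp Require Import all_boot all_order all_fingroup all_algebra.
From mathcomp Require Import spectral complex reals trigo.
From mathcomp Require Import ring lra.
Import Order.TTheory GRing.Theory Num.Theory.
Local Open Scope ring_scope.

(* Put t = (1 - mu)/2 and let q_{i0} = t.  The two other weights have sum 1 - t
   and product t^2, whence, for indices in Z/3,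
     q_a q_b = t q_{a+b-i0} for a <> b,  and  q_a (1 - q_a) = t (1 - q_{2a-i0}).
   For any two admissible phase matrices (the identity included),
   D_a^* D_b is a unimodular multiple of 1 + (w - 1) E_mm, w = e^{+- i theta}.
   As cos theta = 1 - 1/(2t), i.e. |w - 1|^2 = 1/t, the identities above turn
   |<U_k|D_a^* D_b|U_l>|^2 = |delta_kl + (w - 1) conj(U_mk) U_ml|^2
   into q_{k+l-i0-m}, so the permutation s(k) = k + i0 + m works.
   Phases making U unitary exist because the triangle with sides L_k closes up
   (Heron's quantity is t^2 (4t - 1) >= 0), with eta1 = xi1, eta0 = xi1 - xi0. *)

(** * Arithmetic of the three indices modulo 3 *)

Section Ordinal3.

Lemma ord3_ind (P : 'I_3 -> Prop) : P 0 -> P 1 -> P 2%:R -> forall i, P i.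
Proof.
move=> P0 P1 P2 [[|[|[|//]]] hi].
- by rewrite (_ : Ordinal hi = 0) //; apply: val_inj.
- by rewrite (_ : Ordinal hi = 1) //; apply: val_inj.
- by rewrite (_ : Ordinal hi = 2%:R) //; apply: val_inj.
Qed.

Lemma sum_ord3 (V : nmodType) (F : 'I_3 -> V) :
  \sum_k F k = F 0 + F 1 + F 2%:R.
Proof.
rewrite !big_ord_recr big_ord0 /= add0r.
by congr (F _ + F _ + F _); apply: val_inj.
Qed.

Lemma zmod3D : [/\ 1 + 1 = 2%:R :> 'I_3, 1 + 2%:R = 0 :> 'I_3,
  2%:R + 1 = 0 :> 'I_3 & 2%:R + 2%:R = 1 :> 'I_3].
Proof. by split; apply: val_inj. Qed.

Lemma zmod3N : - (1 : 'I_3) = 2%:R /\ - (2%:R : 'I_3) = 1.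
Proof. by split; apply: val_inj. Qed.

End Ordinal3.

(** * Symmetric functions and multiplicative identities of the weights *)

Section Weights.
Variables (R : realType) (mu : R).
Hypothesis hmu : 1 / 3%:R <= mu <= 1 / 2%:R.

Let t := qzero mu.

Lemma qzero_bounds : 1 / 4%:R <= t <= 1 / 3%:R.
Proof. by rewrite /t /qzero; move/andP: hmu => [? ?]; lra. Qed.

Lemma qplusD : qplus mu + qminus mu = 1 - t.
Proof. by rewrite /t /qplus /qminus /qzero; field. Qed.

Lemma qplusM : qplus mu * qminus mu = t ^+ 2.
Proof.
rewrite /qplus /qminus /t /qzero.
(* The discriminant factors as (3 mu - 1)(3 - mu), so its sign is where mu >= 1/3 enters. *)
set D := _ - 4%:R * _; have D0 : 0 <= D.
  by rewrite /D; move/andP: hmu => [? ?]; nra.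
have := sqr_sqrtr D0; rewrite {2}/D; set r := Num.sqrt D => rD.
have -> : (1 + mu + r) / 4%:R * ((1 + mu - r) / 4%:R) =
          ((1 + mu) ^+ 2 - r ^+ 2) / 16%:R by field.
by rewrite rD; field.
Qed.

Lemma qplusminus_gt0 : 0 < qplus mu /\ 0 < qminus mu.
Proof.
have /andP[t1 t2] := qzero_bounds; have S := qplusD; have M := qplusM.
have M0 : 0 < qplus mu * qminus mu by rewrite M; apply: exprn_gt0; lra.
have p0 : 0 < qplus mu.
  rewrite /qplus divr_gt0 // ltr_wpDr ?sqrtr_ge0 //.
  by move/andP: hmu => [? ?]; lra.
by split=> //; move: M0; rewrite pmulr_rgt0.
Qed.

Variable q : 'I_3 -> R.
Hypothesis hq :
  perm_eq [:: q 0; q 1; q 2%:R] [:: qplus mu; qzero mu; qminus mu].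

Lemma weight_gt0 k : 0 < q k.
Proof.
have [p0 m0] := qplusminus_gt0; have /andP[t1 t2] := qzero_bounds.
have z0 : 0 < qzero mu by rewrite -/t; lra.
have := perm_all (fun x => 0 < x) hq; rewrite /= p0 m0 z0 => /and4P[? ? ? _].
by elim/ord3_ind: k.
Qed.

Lemma weight_sum : q 0 + q 1 + q 2%:R = 1.
Proof.
have : \sum_(x <- [:: q 0; q 1; q 2%:R]) x =
  \sum_(x <- [:: qplus mu; qzero mu; qminus mu]) x by exact: perm_big.
rewrite !big_cons !big_nil /= !addr0 addrA => ->.
by have := qplusD; rewrite -/t; lra.
Qed.

Lemma weight_sum2 : \sum_k q k ^+ 2 = mu.
Proof.
have : \sum_(x <- [:: q 0; q 1; q 2%:R]) x ^+ 2 =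
  \sum_(x <- [:: qplus mu; qzero mu; qminus mu]) x ^+ 2 by exact: perm_big.
rewrite sum_ord3 !big_cons !big_nil /= !addr0 addrA => ->.
have -> : qplus mu ^+ 2 + (qzero mu ^+ 2 + qminus mu ^+ 2) =
  (qplus mu + qminus mu) ^+ 2 - 2%:R * (qplus mu * qminus mu) + t ^+ 2.
  by rewrite -/t; ring.
by rewrite qplusD qplusM /t /qzero; field.
Qed.

Lemma weight_prod : q 0 * q 1 * q 2%:R = t ^+ 3.
Proof.
have : \prod_(x <- [:: q 0; q 1; q 2%:R]) x =
  \prod_(x <- [:: qplus mu; qzero mu; qminus mu]) x by exact: perm_big.
rewrite !big_cons !big_nil /= !mulr1 mulrA => ->.
have -> : qplus mu * (qzero mu * qminus mu) = qplus mu * qminus mu * t.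
  by rewrite -/t; ring.
by rewrite qplusM; ring.
Qed.

Lemma weight_center : exists i0, q i0 = t.
Proof.
have := perm_mem hq t; rewrite !inE eqxx orbT => /or3P[] /eqP ->.
- by exists 0.
- by exists 1.
- by exists 2%:R.
Qed.

(** Dividing [weight_prod] by t leaves product t^2 for the two weights away from [i0]. If a and b
    are distinct and both differ from [i0], then a + b - i0 = i0; if a differs from [i0], then 2a -
    i0 is the third index. Each case thus reduces to this product and to the sum 1. *)
Lemma weight_latin : exists i0,
  (forall a b, a != b -> q a * q b = t * q (a + b - i0)) /\
  (forall a, q a * (1 - q a) = t * (1 - q (a + a - i0))).
Proof.
have [D11 D12 D21 D22] := zmod3D; have [N1 N2] := zmod3N.
have zmod3 := (oppr0, N1, N2, add0r, addr0, D11, D12, D21, D22).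
have [i0 Ei0] := weight_center; exists i0; move: Ei0.
have S := weight_sum; have P := weight_prod.
have /andP[t1 _] := qzero_bounds; have t0 : 0 < t by lra.
elim/ord3_ind: i0 => E; rewrite -> E in S, P.
- have P' : q 1 * q 2%:R = t ^+ 2.
    by apply: (mulfI (lt0r_neq0 t0)); rewrite mulrA P; ring.
  by split; [elim/ord3_ind; elim/ord3_ind=> // _|elim/ord3_ind];
    rewrite !zmod3 ?E; nra.
- have P' : q 0 * q 2%:R = t ^+ 2.
    by apply: (mulfI (lt0r_neq0 t0)); rewrite mulrA [t * _]mulrC P; ring.
  by split; [elim/ord3_ind; elim/ord3_ind=> // _|elim/ord3_ind];
    rewrite !zmod3 ?E; nra.
- have P' : q 0 * q 1 = t ^+ 2.
    by apply: (mulIf (lt0r_neq0 t0)); rewrite P; ring.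
  by split; [elim/ord3_ind; elim/ord3_ind=> // _|elim/ord3_ind];
    rewrite !zmod3 ?E; nra.
Qed.

Lemma cos_theta : cos (theta mu) = 1 - (2%:R * t)^-1.
Proof.
move/andP: hmu => [h1 h2]; have m0 : 0 < 1 - mu by lra.
rewrite /theta acosK /t /qzero; first by field; lra.
(* The argument of [acos] is at least -1 exactly when mu <= 1/2. *)
by rewrite in_itv /= ler_pdivlMr // ler_pdivrMr //; apply/andP; split; lra.
Qed.

End Weights.

(** * Unimodular complex numbers *)

Section Phases.
Variable R : realType.
Implicit Types x y : R.

Lemma conj_expi x : (expi x)^* = expi (- x).
Proof. by rewrite /expi cosN sinN. Qed.

Lemma expiD x y : expi (x + y) = expi x * expi y.
Proof.
rewrite /expi cosD sinD; apply/eqP; rewrite eq_complex /= eqxx /=.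
by rewrite addrC [_ * cos y]mulrC eqxx.
Qed.

Lemma expi0 : expi (0 : R) = 1.
Proof. by rewrite /expi cos0 sin0. Qed.

Lemma expiN x : expi x * expi (- x) = 1.
Proof. by rewrite -expiD subrr expi0. Qed.

Lemma expi_conjM x : expi x * (expi x)^* = 1.
Proof. by rewrite conj_expi expiN. Qed.

Lemma expi_conjD x : expi x + (expi x)^* = (2%:R * cos x)%:C%C.
Proof.
rewrite conj_expi /expi cosN sinN.
by apply/eqP; rewrite eq_complex /= subrr eqxx andbT mulrDl !mul1r.
Qed.

End Phases.

(** * Inner products and traces for the bases obtained from [Umx] *)

Section Frames.
Local Open Scope sesquilinear_scope.
Local Open Scope complex_scope.
Variable R : realType.
Implicit Types (M N : 'M[R[i]]_3).

Lemma realC_conj (x : R) : Num.conj (x%:C) = x%:C.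
Proof. exact: conjc_real. Qed.

(** Cyclicity of the trace leaves the scalar product <v|w><w|v>, whose second factor is the
    conjugate of the first. *)
Lemma tr_projectorM (v w : 'cV[R[i]]_3) : \tr (projector v *m projector w) =
  (v^t* *m w) 0 0 * Num.conj ((v^t* *m w) 0 0).
Proof.
rewrite /projector -mulmxA mxtrace_mulC -!mulmxA mulmxA trace_mx11 mxE big_ord1.
congr (_ * _).
rewrite !mxE rmorph_sum; apply: eq_bigr => i _.
by rewrite !mxE rmorphM /= conjCK mulrC.
Qed.

Lemma transport_inner M N k l :
  ((transport M std_basis k)^t* *m transport N std_basis l) 0 0 =
  (M^t* *m N) k l.
Proof.
rewrite /transport /std_basis -!colE !mxE; apply: eq_bigr => i _.
by rewrite !mxE.
Qed.

Lemma std_inner M k l :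
  ((std_basis k)^t* *m transport M std_basis l) 0 0 = M k l.
Proof.
rewrite /transport /std_basis -colE trmx_delta map_delta_mx -rowE.
by rewrite !mxE.
Qed.

Definition phase (a : R * R) (i : 'I_3) : R[i] :=
  [:: 1; expi a.1; expi a.2]`_i.

Lemma phase_mxM a M i j : (phase_mx a *m M) i j = phase a i * M i j.
Proof.
rewrite mxE sum_ord3 /phase_mx /matrix3 !mxE /phase.
by elim/ord3_ind: i; rewrite /= !(mul0r, add0r, addr0).
Qed.

Lemma phase_mx0 : phase_mx (0, 0) = 1%:M :> 'M[R[i]]_3.
Proof.
apply/matrixP; elim/ord3_ind; elim/ord3_ind; rewrite !mxE /= ?expi0 //.
Qed.

Lemma phase_conjM a i : phase a i * Num.conj (phase a i) = 1.
Proof.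
by elim/ord3_ind: i; rewrite /phase /= ?expi_conjM // rmorph1 mulr1.
Qed.

Lemma transport_orthonormal M :
  M \is unitarymx -> orthonormal_basis (transport M std_basis).
Proof.
(* [unitarymx] speaks of the rows, M M^* = 1; orthonormality of the columns needs M^* M = 1, hence
   the passage to the adjoint. *)
rewrite -trmxC_unitary => /unitarymxP; rewrite trmxCK => E k l.
by rewrite transport_inner E mxE.
Qed.

Lemma std_orthonormal : orthonormal_basis (std_basis : frame R 3).
Proof.
move=> k l; have := std_inner 1%:M k l.
by rewrite /transport mul1mx => ->; rewrite mxE.
Qed.

Lemma phase_mx_unitary a : phase_mx a \is @unitarymx R[i] 3 3.
Proof.
have E i j : phase_mx a i j = phase a i * (i == j)%:R.
  by rewrite -[phase_mx a]mulmx1 phase_mxM mxE.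
have Et i j : (phase_mx a)^t* i j = Num.conj (phase_mx a j i) by rewrite !mxE.
apply/unitarymxP/matrixP => i j; rewrite phase_mxM Et E [RHS]mxE eq_sym.
case: eqP => [->|_]; last by rewrite mulr0 rmorph0 mulr0.
by rewrite mulr1 phase_conjM.
Qed.

Variables (q : 'I_3 -> R) (xi0 xi1 eta0 eta1 : R).
Hypothesis q_ge0 : forall k, 0 <= q k.
Let U := Umx q xi0 xi1 eta0 eta1.

(** The square roots in [Umx] follow the addition table of Z/3, and the phases cancel whatever the
    four angles are. *)
Lemma Umx_conjM i j : U i j * Num.conj (U i j) = (q (i + j))%:C.
Proof.
have [D11 D12 D21 D22] := zmod3D.
have sq k : (Num.sqrt (q k))%:C * (Num.sqrt (q k))%:C = (q k)%:C :> R[i].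
  by rewrite -rmorphM /= -expr2 sqr_sqrtr.
have sqx k x : (Num.sqrt (q k))%:C * expi x *
    Num.conj ((Num.sqrt (q k))%:C * expi x) = (q k)%:C.
  by rewrite rmorphM /= realC_conj mulrACA sq expi_conjM mulr1.
rewrite /U /Umx /matrix3 mxE.
by elim/ord3_ind: i; elim/ord3_ind: j;
  rewrite /= ?sqx ?realC_conj ?sq ?(add0r, addr0, D11, D12, D21, D22).
Qed.

(** This says D_a^* D_b = lam (1 + (w - 1) E_mm). Only the real part of [w] is prescribed, so that
    e^{i theta} and its conjugate are both allowed and the relation is symmetric. *)
Definition phase_gap (t : R) (a b : R * R) : Prop := exists m lam w,
  [/\ lam * Num.conj lam = 1, w * Num.conj w = 1,
      w + Num.conj w = 2%:R - (t^-1)%:C &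
      forall i, Num.conj (phase a i) * phase b i =
                lam * (if i == m then w else 1)].

Lemma phase_gap_sym t a b : phase_gap t a b -> phase_gap t b a.
Proof.
move=> [m [lam [w [l1 w1 wt E]]]].
exists m, (Num.conj lam), (Num.conj w); rewrite !conjCK; split=> //.
- by rewrite mulrC.
- by rewrite mulrC.
- by rewrite addrC.
move=> i; have := congr1 Num.conj (E i).
rewrite !rmorphM /= conjCK mulrC => ->.
by case: ifP; rewrite ?rmorph1.
Qed.

(** The identity part of D_a^* D_b contributes U^* U = 1, and the correction at [m] involves row [m]
    of U alone. *)
Lemma phase_gap_inner a b m lam w k l :
  U \is unitarymx ->
  (forall i, Num.conj (phase a i) * phase b i =
             lam * (if i == m then w else 1)) ->
  ((phase_mx a *m U)^t* *m (phase_mx b *m U)) k l =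
  lam * ((k == l)%:R + (w - 1) * (Num.conj (U m k) * U m l)).
Proof.
rewrite -trmxC_unitary => /unitarymxP; rewrite trmxCK => UU E.
have {}UU : \sum_i Num.conj (U i k) * U i l = (k == l)%:R.
  have := congr1 (fun M : 'M_3 => M k l) UU; rewrite [1%:M _ _]mxE => <-.
  by rewrite mxE; apply: eq_bigr => i _; rewrite [_^t* _ _]mxE [_^T _ _]mxE.
rewrite -UU mxE (bigD1 m) //= [in RHS](bigD1 m) //=.
have F i : (phase_mx a *m U)^t* k i * (phase_mx b *m U) i l =
    lam * (if i == m then w else 1) * (Num.conj (U i k) * U i l).
  rewrite [_^t* _ _]mxE [_^T _ _]mxE !phase_mxM rmorphM /= -E.
  by rewrite mulrACA.
rewrite F eqxx; under eq_bigr => i ne do rewrite F (negbTE ne) mulr1.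
by rewrite -mulr_sumr; set S := \sum_(_ < _ | _) _; ring.
Qed.

Lemma phase_gap_trace t i0 a b :
  t != 0 -> U \is unitarymx -> phase_gap t a b ->
  (forall x y, x != y -> q x * q y = t * q (x + y - i0)) ->
  (forall x, q x * (1 - q x) = t * (1 - q (x + x - i0))) ->
  exists s : {perm 'I_3}, forall k l,
    \tr (projector (transport (phase_mx a *m U) std_basis k) *m
         projector (transport (phase_mx b *m U) std_basis l)) =
    (q (s k + s l))%:C.
Proof.
move=> t0 Uu [m [lam [w [l1 w1 wt E]]]] Hne Heq.
exists (perm (@addIr _ (i0 + m))) => k l; rewrite !permE /=.
(* The permutation shifts each index by i0 + m; since 3 i0 = 0, the two shifts by [i0] add up to the
   - i0 of the weight identities. *)
have i3 : i0 + i0 = - i0 by elim/ord3_ind: (i0); apply: val_inj.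
have -> : k + (i0 + m) + (l + (i0 + m)) = m + k + (m + l) - i0.
  by rewrite -i3; ring.
rewrite tr_projectorM transport_inner (@phase_gap_inner a b m lam w) //.
set x := Num.conj (U m k) * U m l.
have xx : x * Num.conj x = (q (m + k) * q (m + l))%:C.
  rewrite /x rmorphM /= conjCK mulrACA [_ * U m k]mulrC !Umx_conjM.
  by rewrite -rmorphM.
rewrite rmorphM /= mulrACA l1 mul1r rmorphD rmorphM rmorphB /= rmorph1.
have ww : (w - 1) * (Num.conj w - 1) = (t^-1)%:C.
  have -> : (w - 1) * (Num.conj w - 1) =
    w * Num.conj w - (w + Num.conj w) + 1 by ring.
  by rewrite w1 wt; ring.
(* Off the diagonal the squared modulus is q_{m+k} q_{m+l} / t, and [Hne] applies. *)
case: (eqVneq k l) => [kl|ne]; last first.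
  rewrite mulr0n rmorph0 !add0r mulrACA ww xx -rmorphM /= Hne; last first.
    by apply: contra_neq ne; apply: addrI.
  by rewrite mulKf.
(* On the diagonal x is the real number p = q_{m+k}, and the squared modulus is 1 - p (1 - p) / t,
   which [Heq] evaluates. *)
have xq : x = (q (m + k))%:C by rewrite /x -kl mulrC Umx_conjM.
rewrite mulr1n rmorph1 xq realC_conj -kl.
set p := (_)%:C.
have -> : (1 + (w - 1) * p) * (1 + (Num.conj w - 1) * p) =
  1 + (w + Num.conj w - 2%:R) * p + (w - 1) * (Num.conj w - 1) * p ^+ 2.
  by ring.
rewrite ww wt.
have -> : 1 + (2%:R - (t^-1)%:C - 2%:R) * p + (t^-1)%:C * p ^+ 2 =
  (1 - t^-1 * (q (m + k) * (1 - q (m + k))))%:C.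
  by rewrite /p !(rmorphB, rmorphM, rmorph1) /=; ring.
by rewrite Heq mulKf // opprB addrC subrK.
Qed.

End Frames.

(** * Existence of phases that make [Umx] unitary *)

Section Triangle.
Local Open Scope complex_scope.
Variable R : realType.

(** By the law of cosines, [g] and [h] are the cosines that the two angles must have. Both 1 - g^2
    and 1 - h^2 are multiples of [H], sixteen times Heron's squared area, so the angles exist; with
    opposite signs, the imaginary parts sqrt H / (2a) cancel. *)
Lemma triangle_phases (a b c : R) : 0 < a -> 0 < b -> 0 < c ->
  a ^+ 4 + b ^+ 4 + c ^+ 4 <=
    2%:R * (a ^+ 2 * b ^+ 2 + b ^+ 2 * c ^+ 2 + c ^+ 2 * a ^+ 2) ->
  exists x y, a%:C + b%:C * expi x + c%:C * expi y = 0.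
Proof.
move=> a0 b0 c0 heron.
pose g := (c ^+ 2 - a ^+ 2 - b ^+ 2) / (2%:R * a * b).
pose h := (b ^+ 2 - a ^+ 2 - c ^+ 2) / (2%:R * a * c).
have an := lt0r_neq0 a0; have bn := lt0r_neq0 b0; have cn := lt0r_neq0 c0.
pose H := 2%:R * (a ^+ 2 * b ^+ 2 + b ^+ 2 * c ^+ 2 + c ^+ 2 * a ^+ 2) -
  (a ^+ 4 + b ^+ 4 + c ^+ 4).
have H0 : 0 <= H by rewrite subr_ge0.
have gE : 1 - g ^+ 2 = H / (2%:R * a * b) ^+ 2.
  by rewrite /g /H; field; rewrite an bn.
have hE : 1 - h ^+ 2 = H / (2%:R * a * c) ^+ 2.
  by rewrite /h /H; field; rewrite an cn.
have bnd x d : 1 - x ^+ 2 = H / d ^+ 2 -> -1 <= x <= 1.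
  move=> xE; have : 0 <= 1 - x ^+ 2 by rewrite xE divr_ge0 // sqr_ge0.
  by move=> x2; apply/andP; split; nra.
have gB := bnd _ _ gE; have hB := bnd _ _ hE.
have sE d : 0 < d -> Num.sqrt (H / d ^+ 2) = Num.sqrt H / d.
  by move=> d0; rewrite sqrtrM // sqrtrV ?sqr_ge0 // sqrtr_sqr gtr0_norm.
exists (acos g), (- acos h).
rewrite /expi cosN sinN !acosK ?in_itv //= !sin_acos // gE hE !sE ?mulr_gt0 //.
apply/eqP; rewrite eq_complex /= !(mul0r, subr0, addr0, add0r).
by apply/andP; split; apply/eqP; rewrite /g /h; field; rewrite an ?bn ?cn.
Qed.

Lemma Umx_unitary_exists (q : 'I_3 -> R)
    (e2 := q 1 * q 2%:R + q 2%:R * q 0 + q 0 * q 1) :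
  (forall k, 0 < q k) -> q 0 + q 1 + q 2%:R = 1 ->
  e2 ^+ 2 <= 4%:R * (q 0 * q 1 * q 2%:R) ->
  exists xi0 xi1 eta0 eta1 : R, Umx q xi0 xi1 eta0 eta1 \is unitarymx.
Proof.
move=> q0 q1 Hq.
pose r k := Num.sqrt (q k).
have r0 k : 0 < r k by rewrite sqrtr_gt0.
have rr k : r k ^+ 2 = q k by rewrite sqr_sqrtr // ltW.
have [] := @triangle_phases (r 0 * r 1) (r 1 * r 2%:R) (r 2%:R * r 0).
- exact: mulr_gt0.
- exact: mulr_gt0.
- exact: mulr_gt0.
- have e4 x : x ^+ 4 = (x ^+ 2) ^+ 2 :> R by ring.
  rewrite !e4 !exprMn !rr -subr_ge0.
  (* For sides whose squares are the pairwise products of the weights, Heron's quantity is 4 e_3 e_1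
     - e_2^2 in elementary symmetric functions, and e_1 = 1. *)
  rewrite [X in 0 <= X](_ : _ =
      4%:R * (q 0 * q 1 * q 2%:R) * (q 0 + q 1 + q 2%:R) - e2 ^+ 2).
    by rewrite q1 mulr1 subr_ge0.
  by rewrite /e2; ring.
move=> xi0 [xi1 E].
exists xi0, xi1, (xi1 - xi0), xi1.
set U := Umx _ _ _ _ _.
have qge k : 0 <= q k by exact: ltW.
have UU i j : (U *m U^t*%sesqui) i j = \sum_k U i k * Num.conj (U j k).
  by rewrite mxE; apply: eq_bigr => k _; rewrite !mxE.
have off i j : (U *m U^t*%sesqui) i j = 0 -> (U *m U^t*%sesqui) j i = 0.
  rewrite !UU => /(congr1 Num.conj); rewrite rmorph0 rmorph_sum /= => Eij.
  rewrite -[RHS]Eij; apply: eq_bigr => k _.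
  by rewrite rmorphM /= conjCK mulrC.
have dg i : (U *m U^t*%sesqui) i i = 1.
  have [D11 D12 D21 D22] := zmod3D.
  rewrite UU sum_ord3 !Umx_conjM // -!rmorphD /= -[RHS]/(1%:C).
  congr (_%:C); rewrite -q1.
  by elim/ord3_ind: i; rewrite ?(add0r, addr0, D11, D12, D21, D22); ring.
move: E; rewrite !rmorphM /=; set u := expi xi0; set v := expi xi1.
set s0 := (r 0)%:C; set s1 := (r 1)%:C; set s2 := (r 2%:R)%:C => E.
have s0c : Num.conj s0 = s0 by exact: realC_conj.
have s1c : Num.conj s1 = s1 by exact: realC_conj.
have s2c : Num.conj s2 = s2 by exact: realC_conj.
have uu : u * Num.conj u = 1 by exact: expi_conjM.
have vv : v * Num.conj v = 1 by exact: expi_conjM.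
have E' := congr1 Num.conj E.
rewrite !rmorphD !rmorphM /= rmorph0 s0c s1c s2c in E'.
have wE : expi (xi1 - xi0) = v * Num.conj u by rewrite expiD conj_expi.
(* With this choice of eta0 and eta1, the three row products are conj E, conj v times E and u times
   conj E, up to terms that vanish because u and v are unimodular: one triangle settles them all. *)
have z01 : (U *m U^t*%sesqui) 0 1 = 0.
  rewrite UU sum_ord3 /U /Umx /matrix3 !mxE /= -/s0 -/s1 -/s2 -/u -/v.
  by rewrite !rmorphM /= s0c s1c s2c -[RHS]E'; ring.
have z02 : (U *m U^t*%sesqui) 0 2%:R = 0.
  rewrite UU sum_ord3 /U /Umx /matrix3 !mxE /= -/s0 -/s1 -/s2 -/u -/v wE.
  rewrite !rmorphM /= conjCK s0c s1c s2c.
  transitivity (Num.conj v * (s0 * s1 + s1 * s2 * u + s2 * s0 * v) +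
                s0 * s2 * (1 - v * Num.conj v)); first by ring.
  by rewrite E vv subrr !mulr0 addr0.
have z12 : (U *m U^t*%sesqui) 1 2%:R = 0.
  rewrite UU sum_ord3 /U /Umx /matrix3 !mxE /= -/s0 -/s1 -/s2 -/u -/v wE.
  rewrite !rmorphM /= conjCK s0c s1c s2c.
  transitivity (u * (s0 * s1 + s1 * s2 * Num.conj u + s2 * s0 * Num.conj v) +
                s1 * s2 * (1 - u * Num.conj u) +
                s0 * s1 * u * (v * Num.conj v - 1)); first by ring.
  by rewrite E' uu vv subrr !mulr0 !addr0.
apply/unitarymxP/matrixP => i j; rewrite [RHS]mxE.
elim/ord3_ind: i; elim/ord3_ind: j => /=;
  rewrite ?dg ?z01 ?z02 ?z12 //; exact: off.
Qed.

End Triangle.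

(** * Which pairs of phase matrices differ by a gap *)

Section ThetaGaps.
Variables (R : realType) (mu : R).
Hypothesis hmu : 1 / 3%:R <= mu <= 1 / 2%:R.

Let th := theta mu.
Let t := qzero mu.

Lemma qzero_neq0 : t != 0.
Proof.
have /andP[t1 _] := qzero_bounds R mu hmu.
by apply: lt0r_neq0; rewrite /t; lra.
Qed.

Lemma expi_theta_conjD : expi th + Num.conj (expi th) = 2%:R - (t^-1)%:C%C.
Proof.
have two : 2%:R = (2%:R)%:C%C :> R[i] by rewrite rmorph_nat.
rewrite expi_conjD cos_theta // two -rmorphB /=.
by congr (_%:C%C); rewrite /t; field; exact: qzero_neq0.
Qed.

(** This keeps (theta, theta) apart from the two other phase pairs. *)
Lemma theta_neq0 : th != 0.
Proof.
apply/negP => /eqP E; have := cos_theta R mu hmu; rewrite -/th E cos0.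
move/eqP; rewrite -subr_eq0 opprB addrC subrK invr_eq0 mulf_eq0 pnatr_eq0 /=.
by rewrite (negbTE qzero_neq0).
Qed.

Lemma expi_theta_half : mu = 1 / 2%:R -> expi th = -1.
Proof.
move=> E; have c : cos th = -1.
  by rewrite /th cos_theta // /qzero E; field.
have := cos2Dsin2 th; rewrite c sqrrN expr1n => /eqP.
rewrite -subr_eq0 addrC addKr sqrf_eq0 => /eqP s.
by rewrite /expi c s; apply/eqP; rewrite eq_complex /= oppr0 !eqxx.
Qed.

Let gap := phase_gap R t.

Let e := expi th.

Lemma phase_gap_zero a : a \in phase_pairs mu -> gap (0, 0) a.
Proof.
have ee : e * Num.conj e = 1 := expi_conjM R th.
have et := expi_theta_conjD.
rewrite !inE -/th => /or3P[] /eqP ->.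
- exists 2%:R, 1, e; split; rewrite ?rmorph1 ?mulr1 //.
  by elim/ord3_ind; rewrite /phase /= ?expi0 rmorph1 ?mulr1.
- exists 1, 1, e; split; rewrite ?rmorph1 ?mulr1 //.
  by elim/ord3_ind; rewrite /phase /= ?expi0 rmorph1 ?mulr1.
(* Here diag(1, e, e) = e diag(conj e, 1, 1), so the exceptional entry is the first one. *)
- exists 0, e, (Num.conj e); split; rewrite ?conjCK // 1?mulrC // 1?addrC //.
  by elim/ord3_ind; rewrite /phase /= ?expi0 rmorph1 mul1r ?mulr1.
Qed.

(** Each of the two other pairs differs from (theta, theta) in a single coordinate, which gives the
    gap at once. Between (0, theta) and (theta, 0) the quotient is diag(1, e, conj e); the last
    hypothesis then forces mu = 1/2. *)
Lemma phase_gap_theta a b :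
  a \in phase_pairs mu -> b \in phase_pairs mu -> a != b ->
  (mu < 1 / 2%:R -> (th, th) \in [:: a; b]) -> gap a b.
Proof.
have ee : e * Num.conj e = 1 := expi_conjM R th.
have et := expi_theta_conjD.
have g1 : gap (0, th) (th, th).
  exists 1, 1, e; split; rewrite ?rmorph1 ?mulr1 //.
  by elim/ord3_ind; rewrite /phase /= ?expi0 ?rmorph1 ?mulr1 ?mul1r // mulrC.
have g2 : gap (th, 0) (th, th).
  exists 2%:R, 1, e; split; rewrite ?rmorph1 ?mulr1 //.
  by elim/ord3_ind; rewrite /phase /= ?expi0 ?rmorph1 ?mulr1 ?mul1r // mulrC.
have g3 : (mu < 1 / 2%:R -> false) -> gap (0, th) (th, 0).
  move=> Hh; have /expi_theta_half eN : mu = 1 / 2%:R.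
    by apply/eqP; move/andP: hmu => [_]; rewrite le_eqVlt => /orP[//|/Hh].
  (* At mu = 1/2, e = -1 and diag(1, -1, -1) = - diag(-1, 1, 1). *)
  exists 0, (-1), (-1); split; rewrite ?rmorphN1 ?mulrNN ?mulr1 //.
    by rewrite -et -/th eN rmorphN1.
  by elim/ord3_ind; rewrite /phase /= ?expi0 ?eN ?rmorphN1 ?rmorph1
    ?mulrNN ?mulr1 ?mul1r.
have tN := theta_neq0.
have th1 : ((th, th) == (0, th)) = false by rewrite xpair_eqE (negbTE tN).
have th2 : ((th, th) == (th, 0)) = false.
  by rewrite xpair_eqE (negbTE tN) andbF.
rewrite !inE -/th => /or3P[] /eqP -> /or3P[] /eqP ->; rewrite ?eqxx // => _;
  rewrite ?th1 ?th2 //= => Hh.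
- exact/phase_gap_sym/g3.
- exact: phase_gap_sym.
- exact: phase_gap_sym.
Qed.

End ThetaGaps.

(** * The pairwise relation between bases *)

Section Equibiased.
Local Open Scope complex_scope.
Variable R : realType.

Definition equibiased (q : 'I_3 -> R) (e f : frame R 3) : Prop :=
  exists s : {perm 'I_3},
    (e =1 std_basis \/ f =1 std_basis -> s = 1%g) /\
    forall k l, \tr (projector (e k) *m projector (f l)) = (q (s k + s l))%:C.

Lemma equibiased_sym q e f : equibiased q e f -> equibiased q f e.
Proof.
move=> [s [H1 H2]]; exists s; split; first by case=> H; apply: H1; [right|left].
by move=> k l; rewrite mxtrace_mulC H2 addrC.
Qed.

Lemma tnth4_ind (T : Type) (Q : T -> T -> Prop) (x0 x1 x2 x3 : T) :
  (forall x y, Q x y -> Q y x) ->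
  Q x0 x1 -> Q x0 x2 -> Q x0 x3 -> Q x1 x2 -> Q x1 x3 -> Q x2 x3 ->
  forall i j, i != j ->
    Q (tnth [tuple x0; x1; x2; x3] i) (tnth [tuple x0; x1; x2; x3] j).
Proof.
move=> sym q01 q02 q03 q12 q13 q23.
move=> [[|[|[|[|//]]]] hi] [[|[|[|[|//]]]] hj] //= _;
  rewrite !(tnth_nth x0) /=; by [|exact: sym].
Qed.

Lemma phased_std_equibiased (q : 'I_3 -> R) xi0 xi1 eta0 eta1 a :
  (forall k, 0 <= q k) ->
  equibiased q std_basis
    (transport (phase_mx a *m Umx q xi0 xi1 eta0 eta1) std_basis).
Proof.
move=> q0; exists 1%g; split=> // k l; rewrite !perm1 tr_projectorM std_inner.
by rewrite phase_mxM rmorphM /= mulrACA phase_conjM mul1r Umx_conjM.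
Qed.

(** The entry at (0, 1) has squared modulus q_1 > 0, whereas it is 0 in the standard basis. Hence
    the clause requiring s = 1 is vacuous between two phased bases, and a shift may serve as the
    permutation. *)
Lemma phased_neq_std (q : 'I_3 -> R) xi0 xi1 eta0 eta1 a :
  (forall k, 0 < q k) ->
  ~ transport (phase_mx a *m Umx q xi0 xi1 eta0 eta1) std_basis =1 std_basis.
Proof.
move=> q0 /(_ 1) E;
  have := std_inner _ (phase_mx a *m Umx q xi0 xi1 eta0 eta1) 0 1.
rewrite E -[std_basis 1]mul1mx -/(transport 1%:M std_basis 1) std_inner mxE /=.
rewrite phase_mxM => /esym E0.
have := Umx_conjM R q xi0 xi1 eta0 eta1 (fun k => ltW (q0 k)) 0 1.
have := phase_conjM R a 0.
move/eqP: E0; rewrite mulf_eq0 => /orP[] /eqP ->; rewrite mul0r.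
  by move/eqP; rewrite eq_sym oner_eq0.
move=> _ [] /esym /eqP; rewrite add0r; exact/negP/lt0r_neq0.
Qed.

End Equibiased.

Theorem proposition2 (R : realType) (mu : R)
    (hmu : 1 / 3%:R <= mu <= 1 / 2%:R)
    (q : 'I_3 -> R)
    (hq : perm_eq [:: q 0; q 1; q 2%:R] [:: qplus mu; qzero mu; qminus mu]) :
  \sum_k q k ^+ 2 = mu /\
  (exists xi0 xi1 eta0 eta1 : R, Umx q xi0 xi1 eta0 eta1 \is unitarymx) /\
  (forall xi0 xi1 eta0 eta1 : R,
     Umx q xi0 xi1 eta0 eta1 \is unitarymx ->
     forall alpha beta : R * R,
       alpha \in phase_pairs mu ->
       beta \in phase_pairs mu ->
       alpha != beta ->
       (mu < 1 / 2%:R -> (theta mu, theta mu) \in [:: alpha; beta]) ->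
       let U := Umx q xi0 xi1 eta0 eta1 in
       let V := phase_mx alpha *m U in
       let W := phase_mx beta *m U in
       mutually_equibiased q (four_bases U V W)).
Proof.
have q0 := weight_gt0 R mu hmu q hq; have q1 := weight_sum R mu q hq.
have qge k : 0 <= q k by exact: ltW.
have q2 := weight_sum2 R mu hmu q hq; split=> //; split.
  apply: Umx_unitary_exists => //.
  rewrite (weight_prod R mu hmu q hq).
  (* Since the weights sum to 1 and their squares to mu, e_2 = (1 - mu)/2 = t; the condition becomes
     t^2 <= 4 t^3, that is t >= 1/4. *)
  have -> : q 1 * q 2%:R + q 2%:R * q 0 + q 0 * q 1 = qzero mu.
    rewrite /qzero -q2 sum_ord3.
    transitivity (((q 0 + q 1 + q 2%:R) ^+ 2 -
                   (q 0 ^+ 2 + q 1 ^+ 2 + q 2%:R ^+ 2)) / 2%:R); first by field.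
    by rewrite q1 expr1n.
  have /andP[t1 _] := qzero_bounds R mu hmu.
  by rewrite [_ ^+ 3]exprSr mulrA; nra.
move=> xi0 xi1 eta0 eta1 Uu alpha beta ha hb hab hh U V W.
have [i0 [Hne Heq]] := weight_latin R mu hmu q hq.
(* Reading U as its own phased version lets the pairs (U, V) and (U, W) be handled like (V, W). *)
have UE : U = phase_mx (0, 0) *m U by rewrite phase_mx0 mul1mx.
have pair a b : phase_gap R (qzero mu) a b ->
    equibiased R q (transport (phase_mx a *m U) std_basis)
                   (transport (phase_mx b *m U) std_basis).
  move=> /(phase_gap_trace R q xi0 xi1 eta0 eta1 qge _ i0 a b
    (qzero_neq0 R mu hmu) Uu).
  move=> /(_ Hne Heq) [s Hs]; exists s; split=> //.
  by case=> /(phased_neq_std _ _ _ _ _ _ _ q0).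
have Fu a : phase_mx a *m U \is unitarymx.
  by apply: mul_unitarymx => //; exact: phase_mx_unitary.
split.
- by split=> //; rewrite sum_ord3.
- rewrite /four_bases => -[[|[|[|[|//]]]] hi] //=;
    rewrite (tnth_nth std_basis) /=.
  + exact: std_orthonormal.
  + exact: transport_orthonormal.
  + exact/transport_orthonormal/Fu.
  + exact/transport_orthonormal/Fu.
apply: (tnth4_ind _ (equibiased R q)).
- exact: equibiased_sym.
- by rewrite UE; exact: phased_std_equibiased.
- exact: phased_std_equibiased.
- exact: phased_std_equibiased.
- by rewrite [X in transport X]UE; apply/pair/phase_gap_zero.
- by rewrite [X in transport X]UE; apply/pair/phase_gap_zero.
- exact/pair/phase_gap_theta.
Qed.
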